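(* Let $X$ be a topological space and $x\in X$. Then $X$ has a countable Pytkeev network at $x$ if and only if $X$ has a countable Pytkeev$^*$ network at $x$ and $X$ is countably tight at $x$.
   Context: A subset $A$ of a topological space $X$ accumulates at $x\in X$ if each neighborhood of $x$ contains infinitely many points of $A$. A sequence $(x_n)_{n\in\omega}$ in $X$ accumulates at $x$ if each neighborhood of $x$ contains $x_n$ for infinitely many indices $n\in\omega$. A family $\mathcal N$ of subsets of $X$ is a Pytkeev network at $x\in X$ if for each neighborhood $O_x$ of $x$ and each subset $A\subset X$ with $x\in\overline A$ there is $N\in\mathcal N$ such that $x\in N\subset O_x$, $N\cap A\neq\emptyset$, and moreover $N\cap A$ is infinite if $A$ accumulates at $x$. A family $\mathcal N$ of subsets of $X$ is a Pytkeev$^*$ network at $x\in X$ if for each neighborhood $O_x$ of $x$ and each sequence $(x_n)_{n\in\omega}\in X^\omega$ accumulating at $x$ there is $N\in\mathcal N$ such that $x\in N\subset O_x$ and $N$ contains $x_n$ for infinitely many $n\in\omega$. $X$ is countably tight at $x$ if each $A\subset X$ with $x\in\overline A$ contains an at most countable subset $B\subset A$ with $x\in\overline B$. ''Countable'' means at most countable. *)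

(* Defs.v *)
From mathcomp Require Import all_boot all_order all_algebra.
From mathcomp Require Import mathcomp_extra boolp classical_sets functions.
From mathcomp Require Import cardinality filter topology.

Set Implicit Arguments.
Unset Strict Implicit.
Unset Printing Implicit Defensive.

Local Open Scope classical_set_scope.

(* Neighborhoods [nbhs x] need not be open, and no separation axiom is
   assumed: the library's [limit_point] only asks each neighborhood of x for
   one point of A other than x, which is weaker than the following notion in
   spaces that are not T1. *)
Definition set_accumulating_at {X : topologicalType} (A : set X)
    (x : X) : Prop :=
  forall O, nbhs x O -> infinite_set (O `&` A).

(* Infinitely many indices, not infinitely many values: a constant sequence
   accumulates at its value. *)
Definition seq_accumulating_at {X : topologicalType} (u : nat -> X)
    (x : X) : Prop :=
  forall O, nbhs x O -> infinite_set [set n | O (u n)].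

Definition pytkeev_network {X : topologicalType} (x : X)
    (NN : set (set X)) : Prop :=
  forall (O A : set X), nbhs x O -> closure A x ->
    exists N : set X, [/\ NN N, N x, N `<=` O, N `&` A !=set0 &
      set_accumulating_at A x -> infinite_set (N `&` A)].

Definition pytkeev_star_network {X : topologicalType} (x : X)
    (NN : set (set X)) : Prop :=
  forall (O : set X) (u : nat -> X), nbhs x O -> seq_accumulating_at u x ->
    exists N : set X, [/\ NN N, N x, N `<=` O & infinite_set [set n | N (u n)]].

Definition countably_tight_at {X : topologicalType} (x : X) : Prop :=
  forall A : set X, closure A x ->
    exists B : set X, [/\ B `<=` A, countable B & closure B x].

(* Main.v *)
Require Import Defs.
From mathcomp Require Import all_boot all_order all_algebra.
From mathcomp Require Import mathcomp_extra boolp classical_sets functions.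
From mathcomp Require Import cardinality filter topology.

(** A Pytkeev network at x already has the Pytkeev* property and, when it is
    countable, forces countable tightness; conversely a Pytkeev* network at a
    point of countable tightness is itself a Pytkeev network.  So both
    directions keep the same family of sets, and only the passage between
    subsets and sequences has to be explained.

    From sets to sequences ([pytkeev_network_star]): let u accumulate at x and
    let F be the set of values that u takes infinitely often.  If x is in the
    closure of F, a member of the network meeting F contains a whole infinite
    fibre of u.  Otherwise some neighborhood of x avoids F, all fibres of u over
    it are finite, and therefore the range of u accumulates at x: a member of
    the network with infinitely many values of u has infinitely many indices.

    From sequences to sets ([pytkeev_star_network_tight]): a countable subset B
    of A with x in its closure can be enumerated so that each point occurs
    infinitely often; this sequence accumulates at x and gives a member of the
    network meeting A.  If A accumulates at x, the member must contain
    infinitely many points, so a sequence without repetitions is needed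
    ([accumulating_injective_sequence]).  It comes from a dichotomy on the set D
    of the points of A which lie in every neighborhood of x, a set that may be
    nonempty as no separation axiom is assumed.  If D is infinite, any
    injective sequence in D will do.  If D is finite, A minus D still has x in
    its closure and countable tightness gives a countable B inside it; a
    neighborhood of x cannot meet B in a finite set, for each of these
    finitely many points is missed by some neighborhood of x. *)

Set Implicit Arguments.
Unset Strict Implicit.
Unset Printing Implicit Defensive.

Local Open Scope classical_set_scope.

(** * Closure points of finite sets and accumulation *)

(** A finite intersection of neighborhoods is a neighborhood, so the members of
    a finite set cannot be avoided one at a time without being avoided all
    together. *)
Lemma closure_finite_set (X : topologicalType) (x : X) (F : set X) :
  finite_set F -> closure F x ->
  exists2 b, F b & forall O, nbhs x O -> O b.
Proof.
move=> /finite_seqP[s ->] clF; apply: contrapT => noF.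
have [O xO Os] : exists2 O, nbhs x O & forall b, b \in s -> ~ O b.
  elim: s noF {clF} => [_|b s IHs noF].
    by exists setT => //; exact: filterT.
  have [O xO Os] : exists2 O, nbhs x O & forall b, b \in s -> ~ O b.
    apply: IHs => -[c cs xc]; apply: noF; exists c => //=.
    by rewrite inE cs orbT.
  have [V xV Vb] : exists2 V, nbhs x V & ~ V b.
    apply: contrapT => noV; apply: noF; exists b => [|V xV] /=.
      by rewrite inE eqxx.
    by apply: contrapT => Vb; apply: noV; exists V.
  exists (O `&` V) => [|c]; first exact: filterI.
  by rewrite inE => /orP[/eqP->|/Os Oc] [].
by have [b [bs /(Os b bs)]] := clF O xO.
Qed.

Lemma set_accumulating_closure (X : topologicalType) (x : X) (A : set X) :
  set_accumulating_at A x -> closure A x.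
Proof. by move=> accA O /accA/infinite_setN0[a [Oa Aa]]; exists a. Qed.

Lemma set_accumulating_setD (X : topologicalType) (x : X) (A D : set X) :
  set_accumulating_at A x -> finite_set D -> set_accumulating_at (A `\` D) x.
Proof.
by move=> accA finD O /accA infOA; rewrite setIDA; exact: infinite_setD.
Qed.

(** * From subsets to sequences *)

(** Finitely many points with finite fibres account for finitely many
    indices. *)
Lemma range_accumulating (X : topologicalType) (x : X) (u : nat -> X) :
  seq_accumulating_at u x ->
  ~ closure [set y | infinite_set (u @^-1` [set y])] x ->
  set_accumulating_at (range u) x.
Proof.
move=> accu ncl O xO finOu.
have [V xV VF] : exists2 V, nbhs x V &
    forall y, V y -> finite_set (u @^-1` [set y]).
  apply: contrapT => noV; apply: ncl => V xV; apply: contrapT => VF.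
  apply: noV; exists V => // y Vy; apply: contrapT => infy.
  by apply: VF; exists y.
apply: (accu (O `&` V)); first exact: filterI.
apply: (@sub_finite_set _ _
  (\bigcup_(y in (O `&` V) `&` range u) (u @^-1` [set y]))).
  by move=> n [On Vn]; exists (u n) => //; split=> //; exists n.
apply: bigcup_finite => [|y [[_ Vy] _]]; last exact: VF.
by apply: sub_finite_set finOu => y [[Oy _] uy].
Qed.

Lemma pytkeev_network_star (X : topologicalType) (x : X) (NN : set (set X)) :
  pytkeev_network x NN -> pytkeev_star_network x NN.
Proof.
move=> pytNN O u xO accu.
have [clF|nclF] := pselect (closure [set y | infinite_set (u @^-1` [set y])] x).
  have [N [NNN Nx NO [y [Ny infy]] _]] := pytNN O _ xO clF.
  exists N; split=> //; apply: sub_infinite_set infy => n /= ->; exact: Ny.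
have accr := range_accumulating accu nclF.
have [N [NNN Nx NO _ /(_ accr) infN]] :=
  pytNN O _ xO (set_accumulating_closure accr).
exists N; split=> // finN; apply: infN.
apply: sub_finite_set (finite_image u finN) => y [Ny [n _ unE]].
by exists n => //=; rewrite unE.
Qed.

(** The countable subset consists of one point of A chosen in each member of
    the network that meets A. *)
Lemma countable_pytkeev_network_tight (X : topologicalType) (x : X)
    (NN : set (set X)) :
  countable NN -> pytkeev_network x NN -> countably_tight_at x.
Proof.
move=> cNN pytNN A clA.
have [a0 _] := clA setT filterT.
have [g gP] : {g : set X -> X & forall N, N `&` A !=set0 -> (N `&` A) (g N)}.
  apply: (@choice _ _ (fun N y => N `&` A !=set0 -> (N `&` A) y)) => N.
  have [[y NAy]|NA0] := pselect (N `&` A !=set0); first by exists y.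
  by exists a0.
exists (g @` [set N | NN N /\ N `&` A !=set0]); split.
- by move=> _ [N [_ /gP[_ Ag]] <-].
- apply: sub_countable (card_image_le _ _) _.
  by apply: sub_countable cNN; apply: subset_card_le => N [].
- move=> O xO; have [N [NNN _ NO NA _]] := pytNN O A xO clA.
  by exists (g N); split; [exists N|apply: NO; have [] := gP N NA].
Qed.

(** * From sequences to subsets *)

(** Infinite repetition can be unavoidable: in absence of separation B may be
    finite, and even when B is infinite a neighborhood of x may contain a
    single point of B. *)
Lemma accumulating_sequence_of_countable (X : topologicalType) (x : X)
    (B : set X) :
  countable B -> closure B x ->
  exists2 u : nat -> X, range u `<=` B & seq_accumulating_at u x.
Proof.
move=> /countable_injP[f finj] clB.
have [b0 [Bb0 _]] := clB setT filterT.
(* The point b is placed at all the indices that code a pair (f b, m). *)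
have [u uP] : {u : nat -> X & forall n, B (u n) /\
    forall b (m : nat), B b -> n = pickle (f b, m) -> u n = b}.
  apply: (@choice _ _ (fun n y => B y /\
    forall b (m : nat), B b -> n = pickle (f b, m) -> y = b)) => n.
  have [[b [m [Bb nE]]]|nob] :=
    pselect (exists b (m : nat), B b /\ n = pickle (f b, m)).
    exists b; split=> // c k Bc; rewrite nE => /(pcan_inj pickleK)[fE _].
    by apply: finj; rewrite ?inE.
  by exists b0; split=> // b m Bb nE; case: nob; exists b, m.
exists u => [_ [n _ <-]|O xO]; first by have [] := uP n.
have [b [Bb Ob]] := clB O xO => finO.
apply: infinite_nat.
have finP : finite_set
    ((fun m : nat => pickle (f b, m)) @^-1` [set n | O (u n)]).
  by apply: finite_preimage finO => m k _ _ /(pcan_inj pickleK)[].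
apply: sub_finite_set finP => m _ /=.
by have [_ /(_ b m Bb erefl) ->] := uP (pickle (f b, m)).
Qed.

Lemma surj_nat_section (T : Type) (D : set T) (f : T -> nat) :
  set_surj D setT f -> exists2 u : nat -> T, range u `<=` D & cancel u f.
Proof.
move=> fsurj.
have [u uP] : {u : nat -> T & forall n, D (u n) /\ f (u n) = n}.
  apply: (@choice _ _ (fun n y => D y /\ f y = n)) => n.
  by have [a Da <-] := fsurj n I; exists a.
by exists u => [_ [n _ <-]|n]; have [] := uP n.
Qed.

(** An enumeration of B without repetitions accumulates at x, because finitely
    many indices yield finitely many points. *)
Lemma accumulating_injective_sequence_of_countable (X : topologicalType)
    (x : X) (B : set X) :
  countable B -> set_accumulating_at B x ->
  exists u : nat -> X,
    [/\ injective u, range u `<=` B & seq_accumulating_at u x].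
Proof.
move=> cB accB.
have infB : infinite_set B.
  by apply: sub_infinite_set (accB setT filterT) => b [].
have /card_set_bijP[f [_ finj fsurj]] := eq_card_nat cB infB.
have [u uB uK] := surj_nat_section fsurj.
have fK : {in B, cancel f u}.
  move=> b /[!inE] Bb; have Bu : B (u (f b)) by apply: uB; exists (f b).
  by apply: finj; rewrite ?inE.
exists u; split=> // [|O xO finO]; first exact: can_inj uK.
apply: (accB O xO); apply: sub_finite_set (finite_image u finO) => b [Ob Bb].
by exists (f b) => /=; rewrite fK ?inE.
Qed.

(** Countable tightness alone might return a finite set, made of points lying in
    every neighborhood of x.  If there are infinitely many such points in A,
    they form a sequence by themselves; otherwise tightness is applied after
    discarding them. *)
Lemma accumulating_injective_sequence (X : topologicalType) (x : X)
    (A : set X) :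
  countably_tight_at x -> set_accumulating_at A x ->
  exists u : nat -> X,
    [/\ injective u, range u `<=` A & seq_accumulating_at u x].
Proof.
move=> tight accA.
pose D := [set a | A a /\ forall O, nbhs x O -> O a].
have [finD|infD] := pselect (finite_set D).
  have clAD := set_accumulating_closure (set_accumulating_setD accA finD).
  have [B [BAD cB clB]] := tight _ clAD.
  have accB : set_accumulating_at B x.
    move=> O xO finOB.
    have clOB : closure (O `&` B) x.
      move=> V xV; have [b [Bb [Ob Vb]]] := clB _ (filterI xO xV).
      by exists b.
    have [b [_ Bb] xb] := closure_finite_set finOB clOB.
    by have [Ab] := BAD b Bb; apply; split.
  have [u [uinj uB accu]] :=
    accumulating_injective_sequence_of_countable cB accB.
  by exists u; split=> // y /uB/BAD[].
have /infiniteP/pcard_surjP[f fsurj] := infD.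
have [u uD uK] := surj_nat_section fsurj.
exists u; split=> [|y /uD[]//|O xO]; first exact: can_inj uK.
apply: sub_infinite_set infinite_nat => n _.
have [_ xu] : D (u n) by apply: uD; exists n.
exact: xu.
Qed.

Lemma pytkeev_star_network_tight (X : topologicalType) (x : X)
    (NN : set (set X)) :
  countably_tight_at x -> pytkeev_star_network x NN -> pytkeev_network x NN.
Proof.
move=> tight starNN O A xO clA.
have [accA|naccA] := pselect (set_accumulating_at A x).
  have [u [uinj uA accu]] := accumulating_injective_sequence tight accA.
  have [N [NNN Nx NO infN]] := starNN O u xO accu.
  have infNA : infinite_set (N `&` A).
    move=> finNA; apply: infN.
    rewrite (_ : [set n | N (u n)] = u @^-1` (N `&` A)).
      by apply: finite_preimage finNA => n m _ _; exact: uinj.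
    by apply/seteqP; split=> n /=; [split=> //; apply: uA; exists n|case].
  by exists N; split=> //; exact: infinite_setN0.
have [B [BA cB clB]] := tight A clA.
have [u uB accu] := accumulating_sequence_of_countable cB clB.
have [N [NNN Nx NO infN]] := starNN O u xO accu.
have [n Nn] := infinite_setN0 infN.
exists N; split=> //; exists (u n); split=> //.
by apply: BA; apply: uB; exists n.
Qed.

Theorem corollary3p7 (X : topologicalType) (x : X) :
  (exists NN : set (set X), countable NN /\ pytkeev_network x NN) <->
  ((exists NN : set (set X), countable NN /\ pytkeev_star_network x NN) /\
   countably_tight_at x).
Proof.
split=> [[NN [cNN pytNN]]|[[NN [cNN starNN]] tight]].
  split; last exact: countable_pytkeev_network_tight cNN pytNN.
  by exists NN; split=> //; exact: pytkeev_network_star.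
by exists NN; split=> //; exact: pytkeev_star_network_tight.
Qed.
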